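(* Let $\sigma>0$, $a>0$, $\xi_0<\xi_1$, and $f(t)=e^{2\pi i\xi_0t}+ae^{2\pi i\xi_1t}$. Suppose $(t_0,\eta_0)\in\mathbb{R}^2$ is a zero of $V_f^{(h)}(t,\eta)$. Then there exists $r>0$ such that for every $0<\rho<r$ the ellipse $$\mathcal{E}_\rho=\{(t,\eta)\in\mathbb{R}^2:\ (t-t_0)^2+\pi^2\sigma^4(\eta-\eta_0)^2=(\sigma\rho)^2\}$$ contains no zeros of $V_f^{(h)}$ on its boundary (i.e. on the curve $\mathcal{E}_\rho$) and contains exactly one zero of $V_f^{(h)}$ in its interior. Furthermore, the closed curve $V_f^{(h)}|_{\mathcal{E}_\rho}$ in $\mathbb{C}\setminus\{0\}$ winds about $0$ exactly once.
   Context: The window is the Gaussian $h(x)=\frac{1}{\sigma\sqrt{\pi}}e^{-x^2/\sigma^2}$. The (modified) short-time Fourier transform is $V_f^{(h)}(t,\eta)=\int_{-\infty}^\infty f(x)h(x-t)e^{-2\pi i\eta(x-t)}dx$; here, with $\Delta=\xi_1-\xi_0$, $V_f^{(h)}(t,\eta)=e^{2\pi i\xi_0t}\left(e^{-\pi^2\sigma^2(\eta-\xi_0)^2}+ae^{2\pi i\Delta t}e^{-\pi^2\sigma^2(\eta-\xi_1)^2}\right)$. Winding ''exactly once'' means that the total phase change along one traversal of the curve is $2\pi$ in absolute value. *)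

(* Defs.v *)
From mathcomp Require Import all_boot all_order all_algebra.
From mathcomp Require Import complex.
From mathcomp Require Import all_classical all_reals all_analysis.

Set Implicit Arguments.
Unset Strict Implicit.
Unset Printing Implicit Defensive.

Import Order.TTheory GRing.Theory Num.Theory.
Import numFieldNormedType.Exports.

Local Open Scope classical_set_scope.
Local Open Scope ring_scope.
Local Open Scope complex_scope.

Section Defs.
Variable R : realType.
Implicit Types (f : R -> R[i]) (h : R -> R).

(* The complex number exp(i * theta). *)
Definition expi (theta : R) : R[i] := cos theta +i* sin theta.

(* Lebesgue integral over the real line, componentwise. As Rintegral is total,
   the value is meaningful only when both components are integrable. *)
Definition complex_integral f : R[i] :=
  (\int[lebesgue_measure]_(x in setT) complex.Re (f x))
    +i* (\int[lebesgue_measure]_(x in setT) complex.Im (f x)).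

Definition gaussian_window (sigma x : R) : R :=
  (sigma * Num.sqrt pi)^-1 * expR (- (x ^+ 2 / sigma ^+ 2)).

(* "Modified": the kernel is exp(-2 pi i eta (x - t)), not exp(-2 pi i eta x). *)
Definition stft f h (t eta : R) : R[i] :=
  complex_integral
    (fun x => f x * (h (x - t))%:C * expi (- (2 * pi * eta * (x - t)))).

Definition two_tone (a xi0 xi1 t : R) : R[i] :=
  expi (2 * pi * xi0 * t) + a%:C * expi (2 * pi * xi1 * t).

Definition ellipse (sigma t0 eta0 rho : R) : set (R * R) :=
  [set p | (p.1 - t0) ^+ 2 + pi ^+ 2 * sigma ^+ 4 * (p.2 - eta0) ^+ 2
           = (sigma * rho) ^+ 2].

Definition ellipse_interior (sigma t0 eta0 rho : R) : set (R * R) :=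
  [set p | (p.1 - t0) ^+ 2 + pi ^+ 2 * sigma ^+ 4 * (p.2 - eta0) ^+ 2
           < (sigma * rho) ^+ 2].

(* One traversal of the ellipse as s runs over [0, 1]; the semi-axes are
   sigma * rho in t and rho / (pi * sigma) in eta. *)
Definition ellipse_path (sigma t0 eta0 rho s : R) : R * R :=
  (t0 + sigma * rho * cos (2 * pi * s),
   eta0 + rho / (pi * sigma) * sin (2 * pi * s)).

(* c restricted to [0, 1] is a closed curve in C \ {0}. *)
Definition punctured_loop (c : R -> R[i]) : Prop :=
  [/\ {within `[0, 1], continuous (c : R -> R[i]^o)},
      c 0 = c 1 &
      forall s : R, s \in `[0, 1] -> c s != 0].

(* theta is a continuous determination of the argument of c along [0, 1]. *)
Definition phase_along (c : R -> R[i]) (theta : R -> R) : Prop :=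
  {within `[0, 1], continuous theta} /\
  forall s : R, s \in `[0, 1] -> c s = `|c s| * expi (theta s).

(* theta 1 - theta 0 does not depend on the choice of theta; the absolute value
   allows either orientation. *)
Definition winds_exactly_once (c : R -> R[i]) : Prop :=
  punctured_loop c /\
  exists2 theta, phase_along c theta & `|theta 1 - theta 0| = 2 * pi.

End Defs.

(* Main.v *)
Require Import Defs.
From mathcomp Require Import all_boot all_order all_algebra.
From mathcomp Require Import complex.
From mathcomp Require Import all_classical all_reals all_analysis.
From mathcomp Require Import measurable_realfun ring lra.

Import Order.TTheory GRing.Theory Num.Theory.
Import numFieldNormedType.Exports.

Local Open Scope classical_set_scope.
Local Open Scope ring_scope.

(** The Fourier transform of a Gaussian is a Gaussian, so V is the explicit
    combination e(xi0 t) (A0(eta) + A1(eta) e(Delta t)) of two carriers with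
    positive amplitudes, where e(x) = exp(2 pi i x) and Delta = xi1 - xi0
    ([stft_two_toneE]).  At a zero the amplitudes agree and the carriers have
    opposite phases; since A1 / A0 is the exponential of an affine function of
    eta, V factors around such a zero as
      V(t, eta) = e(xi0 t) A0(eta) (1 - exp w),
      w = 2 pi Delta (pi sigma^2 (eta - eta0) + i (t - t0))
    ([stft_factorization]).  The first two factors never vanish, and the
    ellipses of the statement are exactly the circles |w| = K with
    K = 2 pi Delta sigma rho.  So all claims concern the map 1 - exp w near
    w = 0, where it behaves like -w.

    The precise form of that last remark is Re ((exp w - 1) conj w) > 0 for
    0 < |w| <= 1/2 ([expm1J_re_gt0]).  It shows that 1 - exp w does not
    vanish on the punctured disc of radius 1/2, and that on the circle |w| = K
      1 - exp w = (- w) ((exp w - 1) conj w) / |w|^2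
    is -w times a number in the open right half-plane.  The argument of that
    number, taken in (-pi/2, pi/2), is a periodic continuous function, so it
    does not contribute to the winding; neither does e(xi0 t), because t comes
    back to its starting value.  Hence V winds as -w does, exactly once.  The
    condition K < 1/2 is rho < 1 / (4 pi Delta sigma).

    For the Fourier transform, write h for the window, put y = x - t and
    I(b) = int h(y) cos (c + b y) dx, for any c and t at once: the derivative
    in b of exp (sigma^2 b^2 / 4) h(y) cos (c + b y) is also the derivative in
    x of a function vanishing at infinity, so exp (sigma^2 b^2 / 4) I(b) does
    not depend on b ([Rintegral_gaussian_window_cos]). *)

(** * Integrals of derivatives over the line *)

(** The integral of F' over [-n, n] is F n - F (- n), which tends to 0, and
    dominated convergence with the dominating function |F'| lets n grow. *)
Lemma Rintegral_derivative_eq0 (R : realType) (f F : R -> R) :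
  (forall x, is_derive x (1 : R) F (f x)) -> continuous f ->
  lebesgue_measure.-integrable setT (EFin \o f) ->
  F x @[x --> +oo] --> (0 : R) -> F x @[x --> -oo] --> (0 : R) ->
  \int[lebesgue_measure]_(x in setT) f x = 0.
Proof.
move=> dF cf intf F_y F_Ny.
have mf : measurable_fun setT f by apply: continuous_measurable_fun.
have cF : continuous F.
  move=> x; apply/differentiable_continuous/derivable1_diffP.
  exact: ex_derive.
pose I (n : nat) : set R := `[(- n.+1%:R), n.+1%:R]%classic.
have intI n : (\int[lebesgue_measure]_x (((f \_ (I n)) x)%:E) =
    (F n.+1%:R - F (- n.+1%:R))%:E)%E.
  transitivity (\int[lebesgue_measure]_(x in I n) (f x)%:E)%E.
    rewrite [RHS]integral_mkcond; apply: eq_integral => x _.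
    by rewrite !patchE; case: ifP.
  rewrite EFinB.
  rewrite (@continuous_FTC2 _ f F) ?gtrN ?ltr0Sn//.
  - exact: continuous_subspaceT.
  - split.
    + by move=> x _; exact: ex_derive.
    + exact: cvg_at_right_filter (cF _).
    + exact: cvg_at_left_filter (cF _).
  - by move=> x _; rewrite derive1E; exact: derive_val.
have lim0 : (F n.+1%:R - F (- n.+1%:R))%:E @[n --> \oo] --> 0%:E.
  apply: cvg_EFin; first exact: nearW.
  rewrite -[X in _ --> X](subr0 0); apply: cvgB.
    rewrite (cvg_shiftS (F \o (fun n : nat => n%:R))).
    exact: cvg_comp cvgr_idn F_y.
  rewrite (cvg_shiftS (fun n : nat => F (- n%:R))).
  apply: (cvg_comp (fun n : nat => - n%:R) F _ F_Ny).
  apply/cvgNry; rewrite (_ : - _ = (fun n => n%:R)); first exact: cvgr_idn.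
  by apply/funext => n; rewrite fctE opprK.
have : (\int[lebesgue_measure]_x ((f \_ (I n)) x)%:E)%E @[n --> \oo] -->
    (\int[lebesgue_measure]_x (f x)%:E)%E.
  have [] // := @dominated_convergence _ _ R lebesgue_measure setT measurableT
    (fun n x => ((f \_ (I n)) x)%:E) (EFin \o f) (fun x => `|(f x)%:E|)%E.
  - move=> n; apply/measurable_EFinP/(measurable_restrictT _ _).1.
      exact: measurable_itv.
    exact: measurable_funTS.
  - exact/measurable_EFinP.
  - apply/aeW => x _; apply: cvg_near_cst.
    have [N _ HN] := @nbhs_infty_ger R `|x|.
    exists N => // n /= Nn; rewrite patchE ifT//; apply/mem_set.
    rewrite /I /= in_itv/= -ler_norml.
    by apply: (le_trans (HN n _)) => //; rewrite ler_nat.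
  - exact: integrable_abse.
  - apply/aeW => x n _; rewrite patchE; case: ifP => // _.
    by rewrite abse0 abse_ge0.
under eq_fun do rewrite intI.
move=> /cvg_unique -/(_ _ _ lim0) E.
by rewrite /Rintegral E.
Qed.

(** * The Gaussian window *)

Section Window.
Variables (R : realType) (sigma : R).
Hypothesis sigma_gt0 : 0 < sigma.
Let sigma_neq0 : sigma != 0. Proof. exact: lt0r_neq0. Qed.
Local Notation mu := (@lebesgue_measure R).
Local Notation gw := (gaussian_window sigma).

Lemma gaussian_window_ge0 x : 0 <= gw x.
Proof. by rewrite mulr_ge0 ?expR_ge0// invr_ge0 mulr_ge0 ?sqrtr_ge0// ltW. Qed.

Lemma is_derive_gaussian_window t x :
  is_derive x (1 : R) (fun y => gw (y - t))
    (- (2 * (x - t) / sigma ^+ 2) * gw (x - t)).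
Proof.
apply: trigger_derive; rewrite /GRing.scale /= /gaussian_window.
by ring.
Qed.

(** The exponent has sigma^2 where the normal density has twice the variance,
    hence the standard deviation sigma / sqrt 2. *)
Lemma gaussian_window_normal_pdf t x :
  gw (x - t) = normal_pdf t (sigma / Num.sqrt 2) x.
Proof.
have s2 : (sigma / Num.sqrt 2) ^+ 2 *+ 2 = sigma ^+ 2.
  by rewrite expr_div_n sqr_sqrtr ?ler0n// -[LHS]mulr_natr divfK// pnatr_eq0.
rewrite normal_pdfE ?mulf_neq0 ?invr_eq0 ?sqrtr_eq0 -?ltNge ?ltr0n//.
rewrite /gaussian_window; congr (_ * _).
  rewrite /normal_peak -mulrnAl s2 sqrtrM ?sqr_ge0// sqrtr_sqr gtr0_norm//.
by rewrite /normal_fun s2 mulNr.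
Qed.

Lemma integrable_gaussian_window t :
  mu.-integrable setT (EFin \o (fun x => gw (x - t))).
Proof.
rewrite (_ : _ \o _ = (fun x => (normal_pdf t (sigma / Num.sqrt 2) x)%:E)).
  exact: integrable_normal_pdf.
by apply/funext => x /=; rewrite gaussian_window_normal_pdf.
Qed.

Lemma Rintegral_gaussian_window t : \int[mu]_(x in setT) gw (x - t) = 1.
Proof.
rewrite /Rintegral.
under eq_integral do rewrite gaussian_window_normal_pdf.
by rewrite integral_normal_pdf.
Qed.

Lemma cvg_gaussian_window_y t : gw (x - t) @[x --> +oo] --> (0 : R).
Proof.
rewrite -(mulr0 (sigma * Num.sqrt pi)^-1); apply: cvgM; first exact: cvg_cst.
apply: (cvg_comp (fun x => (x - t) ^+ 2 / sigma ^+ 2) (fun x => expR (- x))).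
  apply: gt0_cvgMly; first by rewrite invr_gt0 exprn_gt0.
  apply: (cvg_comp (fun x => x - t) (fun x => x ^+ 2)); last exact: cvgr_expr2.
  exact: cvg_addrr.
exact: cvgr_expR.
Qed.

Lemma gaussian_windowN x : gw (- x) = gw x.
Proof. by rewrite /gaussian_window sqrrN. Qed.

Lemma cvg_gaussian_window_Ny t : gw (x - t) @[x --> -oo] --> (0 : R).
Proof.
apply/cvgNy_compNP; rewrite /comp.
rewrite (_ : (fun x => _) = (fun x => gw (x - - t))); last first.
  by apply/funext => x; rewrite -opprD gaussian_windowN opprK.
exact: cvg_gaussian_window_y.
Qed.

(** A first moment costs only a widening of the Gaussian: half of the exponent
    absorbs |y|, because |y| <= sigma (1 + y^2 / (2 sigma^2)) and
    1 + z <= exp z.  It makes |y| h(y) integrable. *)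
Lemma ler_abs_gaussian_window y :
  `|y| * gw y <= Num.sqrt 2 * sigma * gaussian_window (Num.sqrt 2 * sigma) y.
Proof.
have s2 : Num.sqrt 2 ^+ 2 = 2 :> R by rewrite sqr_sqrtr.
have s2_gt0 : 0 < Num.sqrt 2 :> R by rewrite sqrtr_gt0.
have spi_gt0 : 0 < Num.sqrt pi :> R by rewrite sqrtr_gt0 pi_gt0.
rewrite /gaussian_window exprMn s2.
set z := y ^+ 2 / (2 * sigma ^+ 2).
have -> : y ^+ 2 / sigma ^+ 2 = z + z by rewrite /z; field.
have -> : Num.sqrt 2 * sigma *
    ((Num.sqrt 2 * sigma * Num.sqrt pi)^-1 * expR (- z)) =
    (sigma * Num.sqrt pi)^-1 * (sigma * expR (- z)).
  by field; rewrite !gt_eqF.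
rewrite mulrCA ler_pM2l ?invr_gt0 ?mulr_gt0// opprD expRD mulrA.
rewrite ler_pM2r ?expR_gt0// expRN ler_pdivrMr ?expR_gt0//.
apply: le_trans (_ : sigma * (1 + z) <= _); last first.
  by rewrite ler_pM2l// expR_ge1Dx.
have -> : sigma * (1 + z) = (2 * sigma ^+ 2 + `|y| ^+ 2) / (2 * sigma).
  by rewrite /z real_normK ?num_real//; field.
rewrite ler_pdivlMr ?mulr_gt0//.
have := sqr_ge0 (`|y| - sigma); nra.
Qed.

Lemma continuous_gaussian_window t : continuous (fun x => gw (x - t)).
Proof.
move=> x; apply/differentiable_continuous/derivable1_diffP.
have gw' := is_derive_gaussian_window t x; exact: ex_derive.
Qed.

End Window.

(** * The Fourier transform of the Gaussian window *)

Lemma integrable_gaussian_window_cos (R : realType) (sigma c b t : R) :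
  0 < sigma -> lebesgue_measure.-integrable setT
    (EFin \o (fun x => gaussian_window sigma (x - t) * cos (c + b * (x - t)))).
Proof.
move=> sigma_gt0.
apply: (@le_integrable _ _ _ lebesgue_measure setT measurableT _
  (fun x => (gaussian_window sigma (x - t))%:E)).
- apply/measurable_EFinP; apply: continuous_measurable_fun => x.
  apply/differentiable_continuous/derivable1_diffP.
  have gw' := is_derive_gaussian_window _ sigma t x.
  exact: ex_derive.
- move=> x _; rewrite lee_fin normrM ler_piMr//.
  exact: cos_max.
- exact: integrable_gaussian_window.
Qed.

Section GaussianFourier.
Variables (R : realType) (sigma c t : R).
Hypothesis sigma_gt0 : 0 < sigma.
Let sigma_neq0 : sigma != 0. Proof. exact: lt0r_neq0. Qed.
Local Notation mu := (@lebesgue_measure R).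
Local Notation gw := (gaussian_window sigma).

(** The integrand of the transform at frequency b, divided by the value expected
    of its dependence on b: the claim is that its integral is constant in b. *)
Let twisted b x := expR ((sigma * b / 2) ^+ 2) *
  (gw (x - t) * cos (c + b * (x - t))).

Let primitive b x := sigma ^+ 2 / 2 * expR ((sigma * b / 2) ^+ 2) *
  (gw (x - t) * sin (c + b * (x - t))).

(** Both the b-derivative of [twisted] and the x-derivative of [primitive]; this
    coincidence is the real form of shifting the contour in the complex Gaussian
    integral. *)
Let dtwisted b x := expR ((sigma * b / 2) ^+ 2) * gw (x - t) *
  (sigma ^+ 2 * b / 2 * cos (c + b * (x - t)) - (x - t) * sin (c + b * (x - t))).

Let is_derive_twisted b x : is_derive b (1 : R) (twisted ^~ x) (dtwisted b x).
Proof.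
rewrite /twisted; apply: trigger_derive; rewrite /GRing.scale /= /dtwisted.
by field.
Qed.

Let is_derive_primitive b x : is_derive x (1 : R) (primitive b) (dtwisted b x).
Proof.
have gw' := is_derive_gaussian_window _ sigma t x.
rewrite /primitive; apply: trigger_derive; rewrite /GRing.scale /= /dtwisted.
by field.
Qed.

Let continuous_dtwisted b : continuous (dtwisted b).
Proof.
move=> x; apply/differentiable_continuous/derivable1_diffP.
have gw' := is_derive_gaussian_window _ sigma t x.
rewrite /dtwisted; exact: ex_derive.
Qed.

Let integrable_twisted b : mu.-integrable setT (EFin \o twisted b).
Proof.
rewrite (_ : _ \o _ = (fun x => (expR ((sigma * b / 2) ^+ 2))%:E *
  (gw (x - t) * cos (c + b * (x - t)))%:E)%E); last exact/funext.
by apply: integrableZl => //; exact: integrable_gaussian_window_cos.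
Qed.

(** An integrable bound of the b-derivative, uniform for |b| < M, as needed to
    differentiate under the integral sign. *)
Let dominating M x := expR ((sigma * M / 2) ^+ 2) *
  (sigma ^+ 2 * M / 2 * gw (x - t) + `|x - t| * gw (x - t)).

Let integrable_dominating M : mu.-integrable setT (EFin \o dominating M).
Proof.
rewrite (_ : _ \o _ = (fun x => (expR ((sigma * M / 2) ^+ 2))%:E *
    ((sigma ^+ 2 * M / 2)%:E * (gw (x - t))%:E + (`|x - t| * gw (x - t))%:E))%E).
  apply: integrableZl => //; apply: integrableD => //.
    by apply: integrableZl => //; exact: integrable_gaussian_window.
  apply: (@le_integrable _ _ _ mu setT measurableT _ (fun x =>
    ((Num.sqrt 2 * sigma)%:E * (gaussian_window (Num.sqrt 2 * sigma) (x - t))%:E)%E)).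
  - apply/measurable_EFinP; apply: continuous_measurable_fun => x.
    apply: cvgM; last exact: continuous_gaussian_window.
    apply: cvg_norm; exact: (cvgB cvg_id (cvg_cst _)).
  - move=> x _; rewrite -EFinM lee_fin normrM normr_id.
    rewrite [X in _ * X]ger0_norm ?gaussian_window_ge0//.
    apply: le_trans (ler_norm _); exact: ler_abs_gaussian_window.
  - apply: integrableZl => //; apply: integrable_gaussian_window.
    by rewrite mulr_gt0// sqrtr_gt0.
by apply/funext => x; rewrite /= /dominating EFinM EFinD EFinM.
Qed.

Let ler_abs_dtwisted M b x : b \in `](- M), M[ ->
  `|dtwisted b x| <= dominating M x.
Proof.
rewrite in_itv/= -ltr_norml => bM.
have M0 : 0 < M by exact: le_lt_trans bM.
have gw0 : 0 <= gw (x - t) by exact: gaussian_window_ge0.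
have -> : dtwisted b x = expR ((sigma * b / 2) ^+ 2) * (gw (x - t) *
  (sigma ^+ 2 * b / 2 * cos (c + b * (x - t)) - (x - t) * sin (c + b * (x - t)))).
  by rewrite /dtwisted mulrA.
have -> : dominating M x = expR ((sigma * M / 2) ^+ 2) * (gw (x - t) *
  (sigma ^+ 2 * M / 2 + `|x - t|)).
  by rewrite /dominating -mulrDl [gw _ * _]mulrC.
rewrite normrM [`|gw _ * _|]normrM (ger0_norm (expR_ge0 _)) (ger0_norm gw0).
apply: ler_pM => //.
- by rewrite mulr_ge0.
- rewrite ler_expR -[leLHS]real_normK ?num_real// -[leRHS]real_normK ?num_real//.
  rewrite lerXn2r ?nnegrE// !normrM ler_pM2r ?normr_gt0 ?invr_eq0//.
  rewrite ler_pM2l ?normr_gt0// (ltW (lt_le_trans bM _))// ler_norm//.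
- rewrite ler_wpM2l// (le_trans (ler_normB _ _))// lerD//.
    rewrite normrM (le_trans (ler_piMr _ (cos_max _)))//.
    rewrite !(mulrAC (sigma ^+ 2) _ 2^-1) normrM gtr0_norm ?divr_gt0 ?exprn_gt0//.
    by rewrite ler_pM2l ?divr_gt0 ?exprn_gt0// ltW.
  by rewrite normrM ler_piMr// sin_max.
Qed.

Let Rintegral_dtwisted b : \int[mu]_(x in setT) dtwisted b x = 0.
Proof.
have gwsin x : `|primitive b x| <= sigma ^+ 2 / 2 * expR ((sigma * b / 2) ^+ 2) *
    gw (x - t).
  rewrite /primitive mulrA normrM.
  have K_ge0 : 0 <= sigma ^+ 2 / 2 * expR ((sigma * b / 2) ^+ 2) * gw (x - t).
    rewrite mulr_ge0 ?gaussian_window_ge0// mulr_ge0 ?expR_ge0//.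
    by rewrite divr_ge0 ?sqr_ge0.
  by rewrite ger0_norm// ler_piMr// sin_max.
have vanish (F : set_system R) : Filter F -> gw (x - t) @[x --> F] --> (0 : R) ->
    primitive b x @[x --> F] --> (0 : R).
  move=> FF gwF; apply: norm_cvg0.
  apply: (@squeeze_cvgr _ _ _ _ (cst 0) _ _ _ _ _ _); last 2 first.
  - exact: cvg_cst.
  - rewrite -(mulr0 (sigma ^+ 2 / 2 * expR ((sigma * b / 2) ^+ 2))).
    by apply: cvgM; [exact: cvg_cst|exact: gwF].
  by apply: nearW => x; rewrite normr_ge0 gwsin.
apply: (@Rintegral_derivative_eq0 _ _ (primitive b)) => //.
- rewrite (_ : EFin \o _ = EFin \o dtwisted b)//.
  apply: (@le_integrable _ _ _ mu setT measurableT _ (EFin \o dominating (`|b| + 1))).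
  + by apply/measurable_EFinP; exact: continuous_measurable_fun.
  + move=> x _; rewrite lee_fin; apply: le_trans (ler_norm _).
    apply: ler_abs_dtwisted; rewrite in_itv/= -ltr_norml ltrDl//.
  + exact: integrable_dominating.
- by apply: vanish; exact: cvg_gaussian_window_y.
- by apply: vanish; exact: cvg_gaussian_window_Ny.
Qed.

Let is_derive_Rintegral_twisted b :
  is_derive b (1 : R) (fun b => \int[mu]_(x in setT) twisted b x) 0.
Proof.
pose M := `|b| + 1.
have bM : `](- M), M[%classic b by rewrite /= in_itv/= -ltr_norml ltrDl.
have d1 a x : partial1of2 twisted a x = dtwisted a x.
  by rewrite partial1of2E; have d := is_derive_twisted a x; exact: derive_val.
have G0 x : 0 <= dominating M x.
  by apply: le_trans (ler_abs_dtwisted M b x bM).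
have dt a x : `](- M), M[%classic a -> setT x -> derivable (twisted ^~ x) a 1.
  by move=> _ _; have d := is_derive_twisted a x; exact: ex_derive.
have ub a x : `](- M), M[%classic a -> setT x ->
    `|partial1of2 twisted a x| <= dominating M x.
  by move=> aM _; rewrite d1; exact: ler_abs_dtwisted.
have intt a : `](- M), M[%classic a -> mu.-integrable setT (EFin \o twisted a).
  by move=> _; exact: integrable_twisted.
apply: DeriveDef.
  exact: (derivable_under_integral measurableT bM intt dt G0
    (integrable_dominating M) ub).
rewrite -derive1E.
rewrite (differentiation_under_integral measurableT bM intt dt G0
  (integrable_dominating M) ub).
rewrite -[RHS](Rintegral_dtwisted b); apply: eq_Rintegral => x _; exact: d1.
Qed.

(** The integral of [twisted] is constant in b, and at b = 0 it is cos c times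
    the total mass 1 of the window.  The free phase c covers sines as well, by
    shifting it by pi / 2, and t covers translated windows. *)
Lemma Rintegral_gaussian_window_cos b :
  \int[mu]_(x in setT) (gw (x - t) * cos (c + b * (x - t))) =
  cos c * expR (- (sigma * b / 2) ^+ 2).
Proof.
have twistedE a : \int[mu]_(x in setT) twisted a x =
    expR ((sigma * a / 2) ^+ 2) * \int[mu]_(x in setT) (gw (x - t) * cos (c + a * (x - t))).
  by rewrite -RintegralZl//; exact: integrable_gaussian_window_cos.
have := is_derive_0_is_cst b 0 is_derive_Rintegral_twisted.
rewrite !twistedE mulr0 mul0r expr0n/= expR0 mul1r.
under [X in _ = X -> _]eq_Rintegral do rewrite mul0r addr0.
rewrite RintegralZr//; last exact: integrable_gaussian_window.
rewrite Rintegral_gaussian_window// mul1r => <-.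
by rewrite mulrAC -expRD subrr expR0 mul1r.
Qed.

End GaussianFourier.

Local Open Scope complex_scope.

(** * Closed form of the transform *)

Lemma expiD {R : realType} (x y : R) : expi (x + y) = expi x * expi y.
Proof. by rewrite /expi cosD sinD; simpc; congr (_ +i* _); ring. Qed.

Lemma expi_neq0 {R : realType} (x : R) : expi x != 0.
Proof.
apply/eqP => -[c0 s0]; have := cos2Dsin2 x.
by rewrite c0 s0 expr0n addr0 => /eqP; rewrite eq_sym oner_eq0.
Qed.

Section ClosedForm.
Variables (R : realType) (sigma a xi0 xi1 : R).
Hypothesis sigma_gt0 : 0 < sigma.
Local Notation mu := (@lebesgue_measure R).
Local Notation gw := (gaussian_window sigma).
Local Notation V := (stft (two_tone a xi0 xi1) gw).

Lemma Rintegral_gaussian_window_two_cos c0 b0 c1 b1 t :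
  \int[mu]_(x in setT) (gw (x - t) * cos (c0 + b0 * (x - t)) +
                        a * (gw (x - t) * cos (c1 + b1 * (x - t)))) =
  cos c0 * expR (- (sigma * b0 / 2) ^+ 2) +
  a * (cos c1 * expR (- (sigma * b1 / 2) ^+ 2)).
Proof.
have int c b := @integrable_gaussian_window_cos R sigma c b t sigma_gt0.
rewrite RintegralD//.
- by rewrite RintegralZl// !Rintegral_gaussian_window_cos.
- rewrite (_ : _ \o _ = (fun x => a%:E *
    (gw (x - t) * cos (c1 + b1 * (x - t)))%:E)%E); last exact/funext.
  by apply: integrableZl => //; exact: int.
Qed.

(** In terms of y = x - t each tone contributes the window times a single
    oscillation of frequency xi - eta, with a constant phase. *)
Lemma stft_two_toneE t eta : V t eta = expi (2 * pi * xi0 * t) *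
  ((expR (- (pi * sigma * (eta - xi0)) ^+ 2))%:C +
   (a * expR (- (pi * sigma * (eta - xi1)) ^+ 2))%:C *
     expi (2 * pi * (xi1 - xi0) * t)).
Proof.
rewrite /stft /complex_integral.
pose c0 := 2 * pi * xi0 * t; pose c1 := 2 * pi * xi1 * t.
pose b0 := 2 * pi * (xi0 - eta); pose b1 := 2 * pi * (xi1 - eta).
have phase xi x : 2 * pi * xi * x + - (2 * pi * eta * (x - t)) =
    2 * pi * xi * t + 2 * pi * (xi - eta) * (x - t) by ring.
have integrandE x : two_tone a xi0 xi1 x * (gw (x - t))%:C *
    expi (- (2 * pi * eta * (x - t))) =
    (gw (x - t))%:C * expi (c0 + b0 * (x - t)) +
    (a * gw (x - t))%:C * expi (c1 + b1 * (x - t)).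
  by rewrite /c0 /b0 /c1 /b1 -!phase !expiD /two_tone [(a * _)%:C]rmorphM; ring.
have E xi : (sigma * (2 * pi * (xi - eta)) / 2) ^+ 2 =
    (pi * sigma * (eta - xi)) ^+ 2.
  by field.
transitivity ((expR (- (pi * sigma * (eta - xi0)) ^+ 2))%:C * expi c0 +
    (a * expR (- (pi * sigma * (eta - xi1)) ^+ 2))%:C * expi c1); last first.
  have -> : c1 = c0 + 2 * pi * (xi1 - xi0) * t by rewrite /c0 /c1; ring.
  by rewrite expiD; ring.
rewrite -!E; congr Complex.
  transitivity (\int[mu]_(x in setT) (gw (x - t) * cos (c0 + b0 * (x - t)) +
                        a * (gw (x - t) * cos (c1 + b1 * (x - t))))).
    by apply: eq_Rintegral => x _; rewrite integrandE /expi /=; ring.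
  by rewrite Rintegral_gaussian_window_two_cos; ring.
(* The imaginary part: sin is cos delayed by a quarter turn. *)
transitivity (\int[mu]_(x in setT) (gw (x - t) * cos (c0 - pi / 2 + b0 * (x - t)) +
                        a * (gw (x - t) * cos (c1 - pi / 2 + b1 * (x - t))))).
  apply: eq_Rintegral => x _; rewrite integrandE /expi /=.
  by rewrite !(addrAC _ (- (pi / 2))) !cosBpihalf; ring.
by rewrite Rintegral_gaussian_window_two_cos !cosBpihalf; ring.
Qed.

End ClosedForm.

(** * The map 1 - exp w near the origin *)

Lemma sin_mvt {R : realType} (x : R) :
  exists2 c : R, `|c| <= `|x| & sin x = x * cos c.
Proof.
wlog x0 : x / 0 <= x.
  have [?|/ltW x0] := leP 0 x; first exact.
  move=> /(_ (- x)) []; first by rewrite oppr_ge0.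
  move=> c cx; rewrite sinN mulNr => /oppr_inj; exists c => //.
  by rewrite -(normrN x).
have [c] := @MVT_segment R sin cos 0 x x0 (fun y _ => is_derive_sin y)
   (continuous_subspaceT (@continuous_sin R)).
rewrite in_itv/= sin0 !subr0 => /andP[c0 cx] ->; exists c; last by rewrite mulrC.
by rewrite !ger0_norm.
Qed.

Lemma cos_ge_quadratic {R : realType} (x : R) : 1 - x ^+ 2 / 2 <= cos x.
Proof.
have -> : cos x = 1 - 2 * sin (x / 2) ^+ 2.
  rewrite [in LHS](_ : x = (x / 2) *+ 2) ?cos_mulr2n; last by rewrite -mulr_natr divfK.
  by have := cos2Dsin2 (x / 2); lra.
have [c _ ->] := sin_mvt (x / 2).
have : cos c ^+ 2 <= 1 by have := cos2Dsin2 c; have := sqr_ge0 (sin c); lra.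
have := sqr_ge0 x; rewrite !exprMn; nra.
Qed.

(** With w = u + i v, the complex number [expm1J_re u v +i* expm1J_im u v] is
    (exp w - 1) conj w. *)
Definition expm1J_re {R : realType} (u v : R) : R :=
  u * (expR u * cos v - 1) + v * (expR u * sin v).

Definition expm1J_im {R : realType} (u v : R) : R :=
  u * (expR u * sin v) - v * (expR u * cos v - 1).

(** Multiplying and dividing by |w|^2 = w conj w isolates the factor -w, which
    carries the winding. *)
Lemma one_sub_exp_factor {R : realType} (u v : R) : u ^+ 2 + v ^+ 2 != 0 ->
  1 - (expR u)%:C * expi v = ((u ^+ 2 + v ^+ 2)^-1)%:C * (- (u +i* v)) *
    (expm1J_re u v +i* expm1J_im u v).
Proof.
by move=> uv; rewrite /expi /expm1J_re /expm1J_im; simpc; congr Complex; field.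
Qed.

(** To leading order (exp w - 1) conj w is |w|^2.  Its real part is
    u (exp u - 1) + exp u (v sin v - u (1 - cos v)), whose first term is
    positive for nonzero u, while the bracket is at least v^2 / 2: v sin v is
    at least v^2 (1 - v^2 / 2), and u (1 - cos v) is at most |u| v^2 / 2.  The
    radius 1/2 leaves room in these estimates. *)
Lemma expm1J_re_gt0 {R : realType} (u v : R) :
  0 < u ^+ 2 + v ^+ 2 -> u ^+ 2 + v ^+ 2 <= (1 / 2) ^+ 2 ->
  0 < expm1J_re u v.
Proof.
move=> uv_gt0 uv_le; rewrite /expm1J_re.
have -> : u * (expR u * cos v - 1) + v * (expR u * sin v) =
  u * (expR u - 1) + expR u * (v * sin v - u * (1 - cos v)) by ring.
have cosv := cos_ge_quadratic v.
have cosv1 := cos_le1 v.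
have [c cv sinv] := sin_mvt v.
have cosc := cos_ge_quadratic c.
have c2v2 : c ^+ 2 <= v ^+ 2.
  rewrite -[leLHS]real_normK ?num_real// -[leRHS]real_normK ?num_real//.
  by rewrite lerXn2r ?nnegrE.
have u2 := sqr_ge0 u; have v2 := sqr_ge0 v.
have v_part : v ^+ 2 / 2 <= v * sin v - u * (1 - cos v).
  rewrite sinv mulrA -expr2.
  have u12 : u <= 1 / 2 by nra.
  have : v ^+ 2 * (1 - v ^+ 2 / 2) <= v ^+ 2 * cos c.
    by rewrite ler_wpM2l//; lra.
  have : u * (1 - cos v) <= (1 / 2) * (v ^+ 2 / 2) by nra.
  nra.
have e0 := expR_gt0 u.
have [u0|u_neq0] := eqVneq u 0.
  rewrite u0 expR0 mul0r add0r mul1r -u0; apply: lt_le_trans v_part.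
  by move: uv_gt0; rewrite u0 expr0n add0r; lra.
have u_part : 0 < u * (expR u - 1).
  move: u_neq0; rewrite neq_lt => /orP[u0|u0].
    by rewrite nmulr_rgt0// subr_lt0 expR_lt1.
  by rewrite pmulr_rgt0// subr_gt0 expR_gt1.
apply: ltr_wpDr u_part; rewrite mulr_ge0 ?(ltW e0)//.
by apply: le_trans v_part; rewrite divr_ge0.
Qed.

(** * Curves in polar form *)

Lemma continuous_complex (R : realType) (f g : R -> R) :
  continuous f -> continuous g ->
  continuous (fun s => (f s +i* g s) : R[i]^o).
Proof.
move=> cf cg s; apply/(@cvgrPdist_le _ R[i]^o) => -[e1 e2].
rewrite ltcE /= => /andP[/eqP-> e1_gt0].
have e_gt0 : 0 < e1 / 2 by rewrite divr_gt0.
have /cvgrPdist_le/(_ _ e_gt0) nearf := cf s.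
have /cvgrPdist_le/(_ _ e_gt0) nearg := cg s.
near=> x.
have -> : (f s +i* g s) - (f x +i* g x) = (f s - f x)%:C + 'i * (g s - g x)%:C.
  by simpc.
apply: le_trans (ler_normD _ _) _; rewrite normrM !normc_def /=.
rewrite !(expr0n, expr1n, addr0, add0r, sqrtr1, mul1r) !sqrtr_sqr.
rewrite -rmorphD complexr0 lecR [leRHS]splitr lerD//.
- by near: x.
- by near: x.
Unshelve. all: end_near. Qed.

Lemma real_complex_eq0 (R : realType) (x : R) : (x%:C == 0) = (x == 0).
Proof. by rewrite eq_complex /= eqxx andbT. Qed.

Lemma normc_polar (R : realType) (m x : R) : 0 <= m -> `|m%:C * expi x| = m%:C.
Proof.
move=> m_ge0; rewrite normrM !normc_def /= expr0n addr0 cos2Dsin2 sqrtr1 mulr1.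
by rewrite sqrtr_sqr ger0_norm.
Qed.

Lemma winds_exactly_once_polar (R : realType) (c : R -> R[i])
    (m theta : R -> R) :
  continuous m -> continuous theta -> (forall s, 0 < m s) ->
  (forall s, c s = (m s)%:C * expi (theta s)) ->
  c 0 = c 1 -> `|theta 1 - theta 0| = 2 * pi -> winds_exactly_once c.
Proof.
move=> cm ctheta m_gt0 cE c01 turn; split; last first.
  exists theta => //; split; first exact: continuous_subspaceT.
  by move=> s _; rewrite cE normc_polar// ltW.
split=> //; last first.
  by move=> s _; rewrite cE mulf_neq0 ?expi_neq0// real_complex_eq0 gt_eqF.
apply: continuous_subspaceT.
rewrite (_ : c = fun s => (m s * cos (theta s)) +i* (m s * sin (theta s))).
  apply: continuous_complex => s; apply: cvgM; try exact: cm.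
  - by apply: (cvg_comp theta cos); [exact: ctheta|exact: continuous_cos].
  - by apply: (cvg_comp theta sin); [exact: ctheta|exact: continuous_sin].
by apply/funext => s; rewrite cE /expi; simpc.
Qed.

(** In the right half-plane the arctangent is a continuous argument.  The
    modulus appears as x / cos of the argument, which avoids a square root. *)
Lemma polar_half_plane (R : realType) (x y : R) : 0 < x ->
  x +i* y = (x / cos (atan (y / x)))%:C * expi (atan (y / x)).
Proof.
move=> x_gt0.
have c_gt0 : 0 < cos (atan (y / x)).
  by rewrite cos_gt0_pihalf// atan_gtNpi2 atan_ltpi2.
have tanE : sin (atan (y / x)) / cos (atan (y / x)) = y / x := atanK (y / x).
rewrite /expi; simpc; congr Complex.
  by rewrite divfK ?gt_eqF.
by rewrite mulrAC -mulrA tanE mulrC divfK ?gt_eqF.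
Qed.

(** * The transform around a zero *)

Section LocalZero.
Variables (R : realType) (sigma a xi0 xi1 t0 eta0 : R).
Hypotheses (sigma_gt0 : 0 < sigma) (a_gt0 : 0 < a) (xi01 : xi0 < xi1).
Local Notation V := (stft (two_tone a xi0 xi1) (gaussian_window sigma)).
Hypothesis V0 : V t0 eta0 = 0.

Let Delta := xi1 - xi0.
Let A eta := expR (- (pi * sigma * (eta - xi0)) ^+ 2).

(** The two terms cancel: the imaginary part gives sin phi = 0, and positivity
    of the amplitudes excludes cos phi = 1. *)
Let zero_amplitude_phase :
  A eta0 = a * expR (- (pi * sigma * (eta0 - xi1)) ^+ 2) /\
  expi (2 * pi * Delta * t0) = - 1.
Proof.
move: V0; rewrite stft_two_toneE// => /eqP.
rewrite mulf_eq0 (negPf (expi_neq0 _)) /=.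
rewrite -/(A eta0) -/Delta.
set B := a * _; set phi := 2 * pi * _ * _.
have B_gt0 : 0 < B by rewrite mulr_gt0// expR_gt0.
have A_gt0 : 0 < A eta0 by exact: expR_gt0.
rewrite /expi => /eqP; simpc => -[re im].
have sin0 : sin phi = 0.
  by move/eqP: im; rewrite mulf_eq0 gt_eqF//= => /eqP.
have cos1 : cos phi = - 1.
  have /eqP := cos2Dsin2 phi.
  rewrite sin0 expr0n addr0 sqrf_eq1 => /orP[/eqP cos1|/eqP//].
  by move: re; rewrite cos1; lra.
split; first by move: re; rewrite cos1; lra.
by rewrite cos1 sin0 complexr0 rmorphN1.
Qed.

(** By [zero_amplitude_phase] the quotient of the second term by the first is -1
    at the zero; elsewhere it is -1 times the exponential of w, because the
    quadratic parts in eta of the two Gaussian exponents cancel. *)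
Lemma stft_factorization t eta :
  V t eta = expi (2 * pi * xi0 * t) * (A eta)%:C *
    (1 - (expR (2 * pi * Delta * (pi * sigma ^+ 2 * (eta - eta0))))%:C *
         expi (2 * pi * Delta * (t - t0))).
Proof.
have [amp phase] := zero_amplitude_phase.
rewrite stft_two_toneE// -/(A eta) -/Delta.
have -> : 2 * pi * Delta * t = 2 * pi * Delta * t0 + 2 * pi * Delta * (t - t0).
  by ring.
rewrite expiD phase.
have -> : a * expR (- (pi * sigma * (eta - xi1)) ^+ 2) =
    A eta * expR (2 * pi * Delta * (pi * sigma ^+ 2 * (eta - eta0))).
  have -> : a = A eta0 * expR ((pi * sigma * (eta0 - xi1)) ^+ 2).
    by rewrite amp -mulrA -expRD addNr expR0 mulr1.
  by rewrite /A -!expRD; congr expR; rewrite /Delta; ring.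
by rewrite rmorphM; ring.
Qed.

(** The real and imaginary parts of w. *)
Let u eta := 2 * pi * Delta * (pi * sigma ^+ 2 * (eta - eta0)).
Let v t := 2 * pi * Delta * (t - t0).

Let Delta_gt0 : 0 < 2 * pi * Delta.
Proof. by rewrite !mulr_gt0 ?pi_gt0// subr_gt0. Qed.

Let radiusE t eta : u eta ^+ 2 + v t ^+ 2 =
  (2 * pi * Delta) ^+ 2 * ((t - t0) ^+ 2 + pi ^+ 2 * sigma ^+ 4 * (eta - eta0) ^+ 2).
Proof. by rewrite /u /v; ring. Qed.

Let stft_neq0 t eta : 0 < u eta ^+ 2 + v t ^+ 2 ->
  u eta ^+ 2 + v t ^+ 2 <= (1 / 2) ^+ 2 -> V t eta != 0.
Proof.
move=> uv_gt0 uv_le; have S0 := expm1J_re_gt0 _ _ uv_gt0 uv_le.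
have uv_neq0 := lt0r_neq0 uv_gt0.
rewrite stft_factorization -/(u eta) -/(v t) one_sub_exp_factor//.
rewrite !mulf_neq0 ?expi_neq0 ?oppr_eq0//.
- by rewrite real_complex_eq0; exact: lt0r_neq0 (expR_gt0 _).
- by rewrite real_complex_eq0 invr_eq0.
- by apply: contra uv_neq0 => /eqP[-> ->]; rewrite expr0n addr0.
- by apply/eqP => -[S_eq0]; rewrite S_eq0 ltxx in S0.
Qed.

Variable rho : R.
Hypothesis rho_gt0 : 0 < rho.
Hypothesis rho_lt : rho < (4 * pi * Delta * sigma)^-1.
(** The radius of the circle in the w-plane that corresponds to the ellipse. *)
Let K := 2 * pi * Delta * (sigma * rho).

Let K_gt0 : 0 < K. Proof. by rewrite mulr_gt0 ?Delta_gt0 ?mulr_gt0. Qed.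

Let K_le : K <= 1 / 2.
Proof.
have DE : 4 * pi * Delta * sigma = 2 * (2 * pi * Delta) * sigma by ring.
have D_gt0 : 0 < 4 * pi * Delta * sigma.
  by rewrite DE mulr_gt0// mulr_gt0 ?Delta_gt0.
have KE : K = rho * (4 * pi * Delta * sigma) / 2 by rewrite /K; field.
by rewrite KE ler_pM2r// -ler_pdivlMr// mul1r ltW.
Qed.

Let K2_le : K ^+ 2 <= (1 / 2) ^+ 2.
Proof. by rewrite lerXn2r ?nnegrE// ltW. Qed.

Lemma stft_neq0_ellipse p : ellipse sigma t0 eta0 rho p -> V p.1 p.2 != 0.
Proof.
rewrite /ellipse /= => pE; apply: stft_neq0; rewrite radiusE pE -exprMn.
  by rewrite exprn_gt0.
exact: K2_le.
Qed.

Lemma stft_unique_zero_ellipse_interior :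
  exists! p, ellipse_interior sigma t0 eta0 rho p /\ V p.1 p.2 = 0.
Proof.
exists (t0, eta0); split.
  split => //; rewrite /ellipse_interior /= !subrr expr0n mulr0 addr0.
  by rewrite exprn_gt0// mulr_gt0.
move=> [t eta] [/= p_in V_eq0].
rewrite /ellipse_interior /= in p_in.
have [uv_eq0|uv_neq0] := eqVneq (u eta ^+ 2 + v t ^+ 2) 0.
  move/eqP: uv_eq0; rewrite paddr_eq0 ?sqr_ge0// !sqrf_eq0 /u /v.
  have pis_neq0 : pi * sigma ^+ 2 != 0 :> R.
    by rewrite mulf_neq0 ?expf_neq0 ?lt0r_neq0// pi_gt0.
  rewrite !(mulf_eq0 (2 * pi * Delta)) !(gt_eqF Delta_gt0) /=.
  by rewrite mulf_eq0 (negPf pis_neq0) /= !subr_eq0 => /andP[/eqP-> /eqP->].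
suff : V t eta != 0 by rewrite V_eq0 eqxx.
apply: stft_neq0.
  by rewrite lt_def uv_neq0 addr_ge0 ?sqr_ge0.
apply: le_trans K2_le; rewrite radiusE.
have -> : K ^+ 2 = (2 * pi * Delta) ^+ 2 * (sigma * rho) ^+ 2 by rewrite /K; ring.
by rewrite ler_wpM2l ?sqr_ge0// ltW.
Qed.

Let path s := ellipse_path sigma t0 eta0 rho s.

Let u_path s : u (path s).2 = K * sin (2 * pi * s).
Proof.
rewrite /u /K /path /=.
move: (pi : R) (pi_gt0 R) => p p_gt0; field.
by rewrite !lt0r_neq0.
Qed.

Let v_path s : v (path s).1 = K * cos (2 * pi * s).
Proof. by rewrite /v /K /path /=; ring. Qed.

Let re_path s := expm1J_re (K * sin (2 * pi * s)) (K * cos (2 * pi * s)).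
Let im_path s := expm1J_im (K * sin (2 * pi * s)) (K * cos (2 * pi * s)).

Let radius_path s : (K * sin (2 * pi * s)) ^+ 2 + (K * cos (2 * pi * s)) ^+ 2 = K ^+ 2.
Proof. by rewrite !exprMn -mulrDr addrC cos2Dsin2 mulr1. Qed.

Let re_path_gt0 s : 0 < re_path s.
Proof. by apply: expm1J_re_gt0; rewrite radius_path ?exprn_gt0. Qed.

Let continuous_re_path : continuous re_path.
Proof.
move=> s; apply/differentiable_continuous/derivable1_diffP.
by rewrite /re_path /expm1J_re; exact: ex_derive.
Qed.

Let continuous_im_path : continuous im_path.
Proof.
move=> s; apply/differentiable_continuous/derivable1_diffP.
by rewrite /im_path /expm1J_im; exact: ex_derive.
Qed.

(** The argument of (exp w - 1) conj w along the ellipse. *)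
Let residual s := atan (im_path s / re_path s).

Let continuous_residual : continuous residual.
Proof.
move=> s; apply: (cvg_comp (fun s => im_path s / re_path s) atan); last first.
  exact: continuous_atan.
apply: cvgM; first exact: continuous_im_path.
by apply: cvgV; [rewrite gt_eqF|exact: continuous_re_path].
Qed.

Let cos_residual_gt0 s : 0 < cos (residual s).
Proof. by rewrite cos_gt0_pihalf// atan_gtNpi2 atan_ltpi2. Qed.

Let path10 : path 1 = path 0.
Proof.
by rewrite /path /ellipse_path mulr1 mulr0 [2 * pi]mulr_natl cos2pi sin2pi cos0 sin0.
Qed.

Let continuous_amplitude : continuous (fun s => A (path s).2).
Proof.
move=> s; apply/differentiable_continuous/derivable1_diffP.
by rewrite /A /path /=; exact: ex_derive.
Qed.

Let continuous_carrier :
  continuous (fun s => 2 * pi * xi0 * (path s).1 + (- (pi / 2) - 2 * pi * s)).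
Proof.
move=> s; apply/differentiable_continuous/derivable1_diffP.
by rewrite /path /=; exact: ex_derive.
Qed.

(** The argument of V is the sum of three terms.  The carrier phase 2 pi xi0 t
    and [residual] take the same value at both ends, and
    w = K (sin + i cos) (2 pi s) gives -w the argument - pi / 2 - 2 pi s, so the
    total change is - 2 pi. *)
Lemma stft_ellipse_winds :
  winds_exactly_once (fun s => V (path s).1 (path s).2).
Proof.
apply: (@winds_exactly_once_polar _ _
  (fun s => A (path s).2 / K * (re_path s / cos (residual s)))
  (fun s => 2 * pi * xi0 * (path s).1 + (- (pi / 2) - 2 * pi * s) + residual s)).
- move=> s; apply: cvgM.
    by apply: cvgM; [exact: continuous_amplitude|exact: cvg_cst].
  apply: cvgM; first exact: continuous_re_path.
  apply: cvgV; first by rewrite gt_eqF.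
  by apply: (cvg_comp residual cos); [exact: continuous_residual|exact: continuous_cos].
- by move=> s; apply: cvgD; [exact: continuous_carrier|exact: continuous_residual].
- by move=> s; rewrite mulr_gt0// divr_gt0// expR_gt0.
- move=> s.
  have uv_neq0 : (K * sin (2 * pi * s)) ^+ 2 + (K * cos (2 * pi * s)) ^+ 2 != 0.
    by rewrite radius_path expf_neq0// gt_eqF.
  rewrite stft_factorization -/(u (path s).2) -/(v (path s).1).
  rewrite u_path v_path one_sub_exp_factor// radius_path.
  rewrite -/(re_path s) -/(im_path s).
  rewrite (polar_half_plane _ (re_path s))// -/(residual s).
  rewrite (expiD (_ + _) (residual s)) (expiD (2 * pi * xi0 * _)).
  have -> : - (K * sin (2 * pi * s) +i* (K * cos (2 * pi * s))) =
      K%:C * expi (- (pi / 2) - 2 * pi * s).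
    rewrite /expi -opprD (addrC (pi / 2)) cosN sinN cosDpihalf sinDpihalf.
    by simpc.
  have -> : (A (path s).2 / K * (re_path s / cos (residual s)))%:C =
     (A (path s).2)%:C * (K ^+ 2)^-1%:C * K%:C * (re_path s / cos (residual s))%:C.
    by rewrite -!rmorphM; congr _%:C; field; rewrite !gt_eqF.
  by ring.
- by rewrite path10.
- have -> : residual 1 = residual 0.
    rewrite /residual /im_path /re_path mulr1 mulr0 [2 * pi]mulr_natl.
    by rewrite cos2pi sin2pi cos0 sin0.
  rewrite path10 mulr1 mulr0 -[RHS]ger0_norm ?mulr_ge0 ?pi_ge0//.
  by rewrite -normrN; congr `|_|; ring.
Qed.

End LocalZero.

Local Close Scope complex_scope.

Theorem proposition2 (R : realType) (sigma a xi0 xi1 t0 eta0 : R) :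
  let V := stft (two_tone a xi0 xi1) (gaussian_window sigma) in
  0 < sigma -> 0 < a -> xi0 < xi1 ->
  V t0 eta0 = 0 ->
  exists2 r : R, 0 < r & forall rho : R, 0 < rho < r ->
    [/\ forall p, ellipse sigma t0 eta0 rho p -> V p.1 p.2 != 0,
        exists! p, ellipse_interior sigma t0 eta0 rho p /\ V p.1 p.2 = 0 &
        winds_exactly_once (fun s =>
          V (ellipse_path sigma t0 eta0 rho s).1
            (ellipse_path sigma t0 eta0 rho s).2)].
Proof.
move=> V sigma_gt0 a_gt0 xi01 V0.
(* This bound is the condition 2 pi Delta sigma rho < 1/2 of the disc where
   (exp w - 1) conj w has positive real part. *)
exists (4 * pi * (xi1 - xi0) * sigma)^-1.
  by rewrite invr_gt0 !mulr_gt0 ?pi_gt0// subr_gt0.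
move=> rho /andP[rho_gt0 rho_lt]; split.
- by move=> p; exact: stft_neq0_ellipse.
- exact: stft_unique_zero_ellipse_interior.
- exact: stft_ellipse_winds.
Qed.
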